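(* Let $G$ be a graph. \begin{itemize} \item Let $X \subseteq V$ such that $u \in X$ and $G*X$ is defined, then $$ q_1(G) = q_1(G\setminus u) + q_1(G*X\setminus u). $$ \item If $\{u,v\}$ is an edge of $G$ where both $u$ and $v$ do not have loops, then \begin{eqnarray*} q_2(G) &=& q_2(G*\{u,v\}\setminus \{u,v\}) + q_2(G\mathbin{\bar{*}} \{v\}*\{u\}\setminus \{u,v\}) + q_2(G\mathbin{\bar{*}} \{u\}\setminus u) \\ &=& q_2(G*\{u,v\}\setminus \{u,v\}) + q_2(G*\{u,v\}\mathbin{\bar{*}} \{v\}\setminus \{u,v\}) + q_2(G\mathbin{\bar{*}} \{u\}\setminus u). \end{eqnarray*} \item Let $Y \subseteq V$ such that $u \in Y$ and $G\mathbin{\bar{*}} Y$ is defined, then $$ q_3(G) = q_3(G\setminus u) + q_3(G\mathbin{\bar{*}} Y\setminus u). $$ \end{itemize}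
   Context: Graphs are undirected without parallel edges, loops allowed, with vertex set $V$; a graph is identified with its symmetric adjacency matrix over $\mathbb{F}_2$ (diagonal entry $1$ iff the vertex has a loop), and $n(\cdot)$ denotes nullity over $\mathbb{F}_2$ (the empty matrix has nullity $0$). $G[X]$ is the induced subgraph (principal submatrix) on $X$, $G\setminus u = G[V\setminus\{u\}]$, and $G\setminus\{u,v\}=G[V\setminus\{u,v\}]$. For $X\subseteq V$ with $G[X]$ nonsingular, $G*X$ is the principal pivot transform of the adjacency matrix on $X$ (again a graph), defined only in that case. $G+X$ is loop complementation: toggle the loops at the vertices of $X$. The dual pivot is $G\mathbin{\bar{*}} X = G+X*X+X$, defined when the pivot inside is defined; operations are applied left to right. The graph polynomials are $q_1(G)=\sum_{X\subseteq V} y^{n(G[X])}$, $q_2(G)=\sum_{X\subseteq V} y^{n(G+X)}$, and $q_3(G)=\sum_{X\subseteq V} y^{n((G+V)[X])}$. *)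

(* Defs.v *)
From HB Require Import structures.
From mathcomp Require Import all_boot all_algebra.

Set Implicit Arguments.
Unset Strict Implicit.
Unset Printing Implicit Defensive.

Import GRing.Theory.
Local Open Scope ring_scope.

(* A graph (no parallel edges, loops allowed) on the finite vertex set [V] is
   its symmetric adjacency matrix over F_2, with rows and columns indexed by
   [V]; vertex [x] has a loop iff [adj G x x = 1]. *)
Record graph (V : finType) := Graph {
  adj :> V -> V -> 'F_2;
  adj_sym : forall x y, adj x y = adj y x
}.

Definition edge (V : finType) (G : graph V) (x y : V) : bool := G x y == 1.
Definition loop (V : finType) (G : graph V) (x : V) : bool := G x x == 1.

(* [S] and [T] are enumerated to turn an [S * T]-indexed array into a MathComp
   matrix. *)
Definition mx_of (S T : finType) (f : S -> T -> 'F_2) : 'M['F_2]_(#|S|, #|T|) :=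
  \matrix_(i, j) f (enum_val i) (enum_val j).

Definition adjmx (V : finType) (G : graph V) : 'M['F_2]_#|V| := mx_of G.

Definition nullity (V : finType) (G : graph V) : nat := \rank (kermx (adjmx G)).

Definition nonsingular (V : finType) (G : graph V) : bool := adjmx G \in unitmx.

Section Operations.
Variables (V : finType) (G : graph V).

Definition induced (X : {set V}) : graph {x : V | x \in X} :=
  @Graph {x : V | x \in X} (fun x y => G (val x) (val y))
    (fun x y => adj_sym G (val x) (val y)).

Definition del (U : {set V}) := induced (~: U).

Definition loopc_adj (X : {set V}) (x y : V) : 'F_2 :=
  G x y + ((x == y) && (x \in X))%:R.

Lemma loopc_sym X x y : loopc_adj X x y = loopc_adj X y x.
Proof.
rewrite /loopc_adj adj_sym (eq_sym y); case: eqP => [->|] //=.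
Qed.

Definition loopc (X : {set V}) : graph V := Graph (loopc_sym X).

(* With A = [P Q; R S], where P = A[X], the principal pivot transform is
     A * X = [P^-1, - P^-1 Q; R P^-1, S - R P^-1 Q]. *)
Definition ppt_block (X : {set V}) :
    'M['F_2]_(#|{: {x | x \in X}}| + #|{: {x | x \notin X}}|) :=
  let P := adjmx (induced X) in
  let Q := mx_of (fun (x : {x | x \in X}) (y : {y | y \notin X}) =>
                    G (val x) (val y)) in
  let R := mx_of (fun (x : {x | x \notin X}) (y : {y | y \in X}) =>
                    G (val x) (val y)) in
  let S := mx_of (fun x y : {x | x \notin X} => G (val x) (val y)) in
  block_mx (invmx P) (- (invmx P *m Q))
           (R *m invmx P) (S - R *m invmx P *m Q).

(* The row (and column) of the block matrix that corresponds to [x]. *)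
Definition block_index (X : {set V}) (x : V) :
    'I_(#|{: {x | x \in X}}| + #|{: {x | x \notin X}}|) :=
  match boolP (x \in X) with
  | AltTrue xX => lshift _ (enum_rank (exist (fun z => z \in X) x xX))
  | AltFalse xX => rshift _ (enum_rank (exist (fun z => z \notin X) x xX))
  end.

Definition pivot_adj (X : {set V}) (x y : V) : 'F_2 :=
  ppt_block X (block_index X x) (block_index X y).

Lemma pivot_sym X x y : pivot_adj X x y = pivot_adj X y x.
Proof.
have oppF2 m n (A : 'M['F_2]_(m, n)) : - A = A.
  by apply/matrixP=> i j; rewrite mxE oppr_pchar2 // pchar_Fp.
suff symB : (ppt_block X)^T = ppt_block X.
  by rewrite /pivot_adj -{2}symB [RHS]mxE.
rewrite /ppt_block; set P := adjmx _; set Q := mx_of _.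
set R := mx_of _; set S := mx_of _.
have tP : P^T = P by apply/matrixP=> i j; rewrite !mxE adj_sym.
have tQ : Q^T = R by apply/matrixP=> i j; rewrite !mxE adj_sym.
have tS : S^T = S by apply/matrixP=> i j; rewrite !mxE adj_sym.
have tR : R^T = Q by rewrite -tQ trmxK.
rewrite tr_block_mx !oppF2 trmx_inv tP !trmx_mul trmx_inv tP tQ tR.
by rewrite linearD /= !trmx_mul trmx_inv tP tQ tR tS mulmxA.
Qed.

(* G * X is defined only when [pivot_defined X] holds; [pivot X] is a total
   function whose value is meaningless otherwise, and similarly for the dual
   pivot G + X * X + X. *)
Definition pivot_defined (X : {set V}) : bool := nonsingular (induced X).

Definition pivot (X : {set V}) : graph V := Graph (pivot_sym X).

End Operations.

Definition dpivot_defined (V : finType) (G : graph V) (X : {set V}) : bool :=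
  pivot_defined (loopc G X) X.

Definition dpivot (V : finType) (G : graph V) (X : {set V}) : graph V :=
  loopc (pivot (loopc G X) X) X.

(* The indeterminate y is ['X]. *)
Definition q1 (V : finType) (G : graph V) : {poly int} :=
  \sum_(X : {set V}) 'X^(nullity (induced G X)).

Definition q2 (V : finType) (G : graph V) : {poly int} :=
  \sum_(X : {set V}) 'X^(nullity (loopc G X)).

Definition q3 (V : finType) (G : graph V) : {poly int} :=
  \sum_(X : {set V}) 'X^(nullity (induced (loopc G [set: V]) X)).

(* Main.v *)
(* For the adjacency matrix A, let L = {(x, Ax)}. Every nullity in q1, q2, q3 is
   the dimension of the part of L cut out by one of the conditions x_i = 0,
   y_i = 0, x_i + y_i = 0 at each vertex i: q1 sums over the first two, q2 over
   the last two, q3 over the outer two. Pivoting exchanges x_i and y_i on X, hence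
   the first two conditions; loop complementation exchanges the last two and the
   dual pivot the outer two; deleting u imposes x_u = 0. Each recursion splits a
   sum according to the conditions at u (and v) and turns them into x_u = 0. *)

Require Import Defs.
From mathcomp Require Import all_boot all_algebra.
From mathcomp Require Import mxabelem.

Set Implicit Arguments.
Unset Strict Implicit.
Unset Printing Implicit Defensive.

Import GRing.Theory.
Local Open Scope ring_scope.

Lemma addF2_self (x : 'F_2) : x + x = 0.
Proof. by rewrite -mulr2n -mulr_natl pchar_Zp // mul0r. Qed.

(** * Counting the points of L that satisfy a condition at each vertex *)

Section Action.
Variable V : finType.
Implicit Types (G : graph V) (x : {ffun V -> 'F_2}) (X : {set V}).
Implicit Types (P : V -> 'F_2 -> 'F_2 -> bool).

Definition act G x (i : V) : 'F_2 := \sum_j G i j * x j.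

(** A vector [x] stands for the point (x, Gx) of L, and [P i] constrains its two coordinates at [i].
    Working with the finite set itself allows dimensions to be compared by plain bijections, without
    proving linearity. *)
Definition sols G P := [set x : {ffun V -> 'F_2} | [forall i, P i (x i) (act G x i)]].

(* [sols G P] is a linear subspace in every use, so this is its dimension. *)
Definition nul G P : nat := trunc_log 2 #|sols G P|.

Lemma eq_nul G P P' :
  (forall i a b, P i a b = P' i a b) -> nul G P = nul G P'.
Proof.
move=> eqP; rewrite /nul; congr (trunc_log _ #|pred_of_set _|).
by apply/setP=> x; rewrite !inE; apply: eq_forallb => i.
Qed.

(** A subspace of dimension d over F_2 has 2^d elements, so the rank of the kernel is recovered by
    counting. *)
Lemma nullityE G : nullity G = nul G (fun _ _ b => b == 0).
Proof.
rewrite /nullity /nul -[LHS](@trunc_expnK 2) //; congr (trunc_log 2 _).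
have {1}-> : 2%N = #|'F_2| by rewrite card_Fp.
rewrite -card_rowg.
pose f (x : {ffun V -> 'F_2}) : 'rV['F_2]_#|V| := \row_k x (enum_val k).
have f_inj : injective f.
  move=> x y /rowP exy; apply/ffunP=> i.
  by have := exy (enum_rank i); rewrite !mxE enum_rankK.
rewrite -(card_imset _ f_inj); congr #|pred_of_set _|.
have kerE (x : {ffun V -> 'F_2}) : (f x \in rowg (kermx (adjmx G))) = (x \in sols G (fun _ _ b => b == 0)).
  have fE i : (f x *m adjmx G) 0 (enum_rank i) = act G x i.
    rewrite mxE /act (reindex_onto enum_rank enum_val) /=; last first.
      by move=> j _; rewrite enum_valK.
    apply: eq_big => [k|k _]; first by rewrite enum_rankK eqxx.
    (* [kermx] is the left kernel, whereas [act] multiplies on the right; symmetry of [G] reconciles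
       the two. *)
    by rewrite !mxE !enum_rankK mulrC adj_sym.
  rewrite !inE sub_kermx.
  apply/eqP/forallP=> [fx0 i|x0]; first by rewrite -fE fx0 mxE.
  by apply/rowP=> k; rewrite -[k]enum_valK fE mxE; apply/eqP.
apply/setP=> w; apply/idP/imsetP=> [ww|[x xs ->]]; last by rewrite kerE.
have wE : w = f [ffun i => w 0 (enum_rank i)].
  by apply/rowP=> k; rewrite mxE ffunE enum_valK.
by exists [ffun i => w 0 (enum_rank i)] => //; rewrite -kerE -wE.
Qed.

Lemma nonsingularE G : nonsingular G = (nullity G == 0%N).
Proof.
by rewrite /nonsingular /nullity mxrank_ker -row_full_unit /row_full subn_eq0
   eqn_leq rank_leq_row.
Qed.

(** [trunc_log 2] vanishes at both 0 and 1, so it suffices that there is at most one solution. *)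
Lemma nul_eq0 G P :
  (forall x, (forall i, P i (x i) (act G x i)) -> forall i, x i = 0) ->
  nul G P = 0%N.
Proof.
move=> P0; have le1 : (#|sols G P| <= 1)%N.
  apply/card_le1_eqP=> x y; rewrite !inE => /forallP/P0 x0 /forallP/P0 y0.
  by apply/ffunP=> i; rewrite x0 y0.
by rewrite /nul; case: #|_| le1 => [|[]].
Qed.

(** * Effect of the graph operations on the conditions *)

Lemma nul_loopc G X P :
  nul (loopc G X) P =
  nul G (fun i a b => P i a (if i \in X then a + b else b)).
Proof.
rewrite /nul; congr (trunc_log _ #|pred_of_set _|).
apply/setP=> x; rewrite !inE; apply: eq_forallb => i; congr (P i _ _).
rewrite /act /= /loopc_adj.
under eq_bigr do rewrite mulrDl.
rewrite big_split /= [X in _ + X](bigD1 i) //= [X in _ + (_ + X)]big1 => [|j ji].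
  by rewrite eqxx addr0; case: ifP => _; rewrite ?mul1r ?mul0r ?addr0 // addrC.
by rewrite [i == j]eq_sym (negPf ji) mul0r.
Qed.

(* The vector [x] in the block order used by [ppt_block]. *)
Definition blockvec X x :=
  col_mx (\col_(k < #|{: {x | x \in X}}|) x (val (enum_val k)))
         (\col_(k < #|{: {x | x \notin X}}|) x (val (enum_val k))).

Lemma blockvecE X x i : blockvec X x (block_index X i) 0 = x i.
Proof.
by rewrite /block_index; case: {-}_ / boolP => iX;
  rewrite ?col_mxEu ?col_mxEd mxE enum_rankK.
Qed.

Definition unblock X (k : 'I_(#|{: {x | x \in X}}| + #|{: {x | x \notin X}}|)) : V :=
  match split k with inl a => val (enum_val a) | inr b => val (enum_val b) end.

Lemma block_indexK X : cancel (block_index X) (@unblock X).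
Proof.
move=> i; rewrite /block_index; case: {-}_ / boolP => iX; rewrite /unblock.
  by rewrite (unsplitK (inl _)) enum_rankK.
by rewrite (unsplitK (inr _)) enum_rankK.
Qed.

Lemma unblockK X : cancel (@unblock X) (block_index X).
Proof.
move=> k; rewrite /unblock; case: splitP => [a|b] ka; apply: val_inj => /=.
  rewrite /block_index; case: {-}_ / boolP => [iX|iX]; last by case/negP: (iX); apply: valP.
  by rewrite ka /= -[in RHS](enum_valK a); congr (val (enum_rank _)); apply: val_inj.
rewrite /block_index; case: {-}_ / boolP => [iX|iX].
  by case/negP: (valP (enum_val b)).
by rewrite ka /= -[in RHS](enum_valK b); congr (_ + val (enum_rank _))%N; apply: val_inj.
Qed.

(** Translates products in block order into [act]; it serves both for [G] with its blocks and for
    [pivot G X] with [ppt_block]. *)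
Lemma mul_blockvec X (M : 'M_(#|{: {x | x \in X}}| + #|{: {x | x \notin X}}|)) G x :
    (forall i j, G i j = M (block_index X i) (block_index X j)) ->
  M *m blockvec X x = blockvec X [ffun i => act G x i].
Proof.
move=> GM; apply/colP=> k; rewrite -[k]unblockK blockvecE mxE ffunE.
rewrite (reindex (block_index X)) /=; last first.
  by exists (@unblock X) => i _; rewrite (block_indexK, unblockK).
by apply: eq_bigr => j _; rewrite blockvecE GM.
Qed.

(* [G * X] sends [swap x] to [swap (G x)], both swaps exchanging the
   [X]-coordinates of [x] and [G x]. *)
Lemma act_pivot G X x i : pivot_defined G X ->
  let swap := [ffun j => if j \in X then act G x j else x j] in
  act (pivot G X) swap i = if i \in X then x i else act G x i.
Proof.
move=> GX /=; set swap := [ffun j => _].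
pose y := [ffun j => act G x j].
suff /colP/(_ (block_index X i)) : blockvec X [ffun j => act (pivot G X) swap j] =
  blockvec X [ffun j => if j \in X then x j else act G x j].
  by rewrite !blockvecE !ffunE.
rewrite -(@mul_blockvec X (ppt_block G X)) //.
pose P := adjmx (induced G X).
pose Q := mx_of (fun (x : {x | x \in X}) (y : {y | y \notin X}) =>
                    G (val x) (val y)).
pose R := mx_of (fun (x : {x | x \notin X}) (y : {y | y \in X}) =>
                    G (val x) (val y)).
pose S := mx_of (fun x y : {x | x \notin X} => G (val x) (val y)).
have : block_mx P Q R S *m blockvec X x = blockvec X y.
  apply: mul_blockvec => j k; rewrite /block_index.
  case: {-}_ / boolP => jX; case: {-}_ / boolP => kX;
  by rewrite ?(block_mxEul, block_mxEur, block_mxEdl, block_mxEdr) mxE !enum_rankK.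
rewrite /ppt_block -/P -/Q -/R -/S /blockvec !mul_block_col.
case/eq_col_mx; set x1 := \col_k x _; set x2 := \col_k x _ => e1 e2.
set s1 := \col_k swap _; set s2 := \col_k swap _.
have -> : s2 = x2.
  by apply/colP=> k; rewrite !mxE ffunE (negPf (valP (enum_val k))).
have -> : s1 = P *m x1 + Q *m x2.
  by rewrite e1; apply/colP=> k; rewrite !mxE !ffunE (valP (enum_val k)).
have uP : P \in unitmx by [].
(* With s1 = P x1 + Q x2, the upper block is P^-1 s1 - P^-1 Q x2 = x1, and in the lower one R P^-1
   s1 = R x1 + R P^-1 Q x2 cancels the correction to S. *)
congr col_mx; last transitivity (R *m x1 + S *m x2).
- rewrite mulmxDr mulmxA mulVmx // mul1mx mulNmx mulmxA addrK.
  by apply/colP=> k; rewrite !mxE ffunE (valP (enum_val k)).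
- rewrite mulmxDr mulmxBl !mulmxA mulmxKV // addrACA subrr addr0.
  by rewrite addrC.
- by rewrite e2; apply/colP=> k; rewrite !mxE !ffunE (negPf (valP (enum_val k))).
Qed.

(** [swap] is injective, hence a permutation of the finite set of vectors, and carries the solutions
    for [G] to those for [pivot G X]. *)
Lemma nul_pivot G X P : pivot_defined G X ->
  nul (pivot G X) P = nul G (fun i a b => if i \in X then P i b a else P i a b).
Proof.
move=> GX; pose swap x := [ffun j => if j \in X then act G x j else x j].
have swap_inj : injective swap.
  (* On [X] the entry [x i] is recovered by applying [pivot G X] to [swap x]; off [X] it is an entry
     of [swap x]. *)
  move=> x x' exx'; apply/ffunP=> i.
  have := act_pivot x i GX; have := act_pivot x' i GX => /=.
  rewrite -!/(swap _) exx' => ->; case: ifP => // iX _.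
  by move/ffunP/(_ i): exx'; rewrite !ffunE iX.
rewrite /nul -(card_preimset _ swap_inj); congr (trunc_log _ #|pred_of_set _|).
apply/setP=> x; rewrite !inE; apply: eq_forallb => i.
by rewrite act_pivot // ffunE; case: ifP.
Qed.

(** On [X] the pair (a, b) passes through (a, a + b) and (a + b, a) to (a + b, b), since 2a = 0. *)
Lemma nul_dpivot G X P : dpivot_defined G X ->
  nul (dpivot G X) P =
  nul G (fun i a b => if i \in X then P i (a + b) b else P i a b).
Proof.
move=> GX; rewrite nul_loopc nul_pivot // nul_loopc; apply: eq_nul => i a b.
by case: (i \in X) => //; rewrite addrAC addF2_self add0r.
Qed.

End Action.

(** Extension by zero identifies vectors on [X] with vectors on [V] vanishing off [X], and does not
    change [act] on [X]. *)
Lemma nul_induced (V : finType) (G : graph V) (X : {set V}) (P : V -> 'F_2 -> 'F_2 -> bool) :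
  nul (induced G X) (fun i => P (val i)) =
  nul G (fun i a b => if i \in X then P i a b else a == 0).
Proof.
pose ext (x : {ffun {x | x \in X} -> 'F_2}) : {ffun V -> 'F_2} :=
  [ffun i => if insub i is Some j then x j else 0].
have extE x (j : {x | x \in X}) : ext x (val j) = x j by rewrite ffunE valK.
have ext0 x i : i \notin X -> ext x i = 0 by move=> iX; rewrite ffunE insubN.
have ext_inj : injective ext.
  by move=> x y exy; apply/ffunP=> j; rewrite -!extE exy.
have actE x (j : {x | x \in X}) : act G (ext x) (val j) = act (induced G X) x j.
  rewrite /act (bigID [in X]) /= [X in _ + X]big1 ?addr0; last first.
    by move=> k kX; rewrite ext0 // mulr0.
  rewrite (reindex_onto val (insubd j)) /=; last by move=> k kX; rewrite insubdK.
  apply: eq_big => [k|k _]; first by rewrite valKd eqxx (valP k).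
  by rewrite extE.
have solE x : (ext x \in sols G (fun i a b => if i \in X then P i a b else a == 0))
    = (x \in sols (induced G X) (fun i => P (val i))).
  rewrite !inE; apply/forallP/forallP=> [xs j|xs i].
    by have := xs (val j); rewrite (valP j) extE actE.
  case: ifPn => iX; last by rewrite ext0.
  by have := xs (exist _ i iX); rewrite -extE -actE.
rewrite /nul -(card_imset _ ext_inj); congr (trunc_log _ #|pred_of_set _|).
apply/setP=> x; apply/imsetP/idP=> [[z zs ->]|xs]; first by rewrite solE.
have xE : x = ext [ffun j => x (val j)].
  apply/ffunP=> i; case: (boolP (i \in X)) => iX.
    by rewrite -[i]/(val (exist [in X] i iX)) extE ffunE.
  rewrite ext0 //; apply/eqP.
  by move: xs; rewrite inE => /forallP/(_ i); rewrite (negPf iX).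
by exists [ffun j => x (val j)] => //; rewrite -solE -xE.
Qed.

(** Puts definedness in terms of [nul], so that it can be traced through earlier operations by the
    same rules as nullities. *)
Lemma pivot_definedE (V : finType) (G : graph V) (X : {set V}) : pivot_defined G X =
  (nul G (fun i a b => if i \in X then b == 0 else a == 0) == 0%N).
Proof.
by rewrite /pivot_defined nonsingularE nullityE
   (nul_induced G X (fun _ _ b => b == 0)).
Qed.

Lemma dpivot_definedE (V : finType) (G : graph V) (X : {set V}) : dpivot_defined G X =
  (nul G (fun i a b => if i \in X then a + b == 0 else a == 0) == 0%N).
Proof.
rewrite /dpivot_defined pivot_definedE nul_loopc; congr (_ == _).
by apply: eq_nul => i a b; case: (i \in X).
Qed.

(** * The three polynomials as one family, and vertex deletion *)

Definition qpoly (p q : 'F_2 -> 'F_2 -> bool) (V : finType) (G : graph V) : {poly int} :=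
  \sum_(X : {set V}) 'X^(nul G (fun i => if i \in X then p else q)).

Lemma q1E V (G : graph V) :
  q1 G = qpoly (fun _ b => b == 0) (fun a _ => a == 0) G.
Proof.
apply: eq_bigr => X _.
rewrite nullityE (nul_induced G X (fun _ _ b => b == 0)); congr 'X^_.
by apply: eq_nul => i a b; case: (i \in X).
Qed.

Lemma q2E V (G : graph V) :
  q2 G = qpoly (fun a b => a + b == 0) (fun _ b => b == 0) G.
Proof.
apply: eq_bigr => X _; rewrite nullityE nul_loopc; congr 'X^_.
by apply: eq_nul => i a b; case: (i \in X).
Qed.

Lemma q3E V (G : graph V) :
  q3 G = qpoly (fun a b => a + b == 0) (fun a _ => a == 0) G.
Proof.
apply: eq_bigr => X _.
rewrite nullityE (nul_induced _ X (fun _ _ b => b == 0)) nul_loopc; congr 'X^_.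
by apply: eq_nul => i a b; rewrite inE; case: (i \in X).
Qed.

(** At the vertices of [U] the only condition is x_i = 0, whatever [X] is there. The trace [Z] of
    [X] on [U] can therefore be chosen freely, to suit the terms to be matched. *)
Lemma qpoly_del p q V (G : graph V) (U Z : {set V}) : Z \subset U ->
  qpoly p q (del G U) =
  \sum_(X | X :&: U == Z)
    'X^(nul G (fun i a b => if i \in U then a == 0
                            else if i \in X then p a b else q a b)).
Proof.
move=> ZU; rewrite (reindex_onto (fun Y : {set {x | x \in ~: U}} => Z :|: val @: Y)
  (fun X => val @^-1: X)) /=; last first.
  move=> X /eqP <-; apply/setP=> i; rewrite !inE.
  case: (boolP (i \in U)) => iU; rewrite (andbT, andbF) /=.
    case: (i \in X) => //=; apply/imsetP=> [[j _ ij]].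
    by case/setCP: (valP j); move: iU; rewrite ij.
  have iU' : i \in ~: U by rewrite inE.
  rewrite -[i]/(val (exist [in ~: U] i iU')) mem_imset ?inE //; exact: val_inj.
have inY (Y : {set {x | x \in ~: U}}) (j : {x | x \in ~: U}) :
    (val j \in Z :|: val @: Y) = (j \in Y).
  rewrite inE mem_imset; last exact: val_inj.
  have /[!inE] jU := valP j.
  by rewrite (contraNF (subsetP ZU (val j))).
apply: eq_big => [Y|Y _].
  apply/esym/andP; split; last by apply/eqP/setP=> j; rewrite inE inY.
  rewrite setIUl (setIidPl ZU) (_ : _ :&: _ = set0) ?setU0 //.
  apply/setP=> i; rewrite !inE; apply/andP=> [[/imsetP[j _ ->]]].
  by have := valP j; rewrite inE => /negPf->.
congr 'X^_.
transitivity (nul (del G U) (fun i => if val i \in Z :|: val @: Y then p else q)).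
  by apply: eq_nul => i a b; rewrite inY.
rewrite (nul_induced G (~: U) (fun i => if i \in Z :|: val @: Y then p else q)).
by apply: eq_nul => i a b; rewrite in_setC; case: (i \in U) => //=; case: ifP.
Qed.

(** * The common recursion behind q1 and q3 *)

Lemma setI1_eq0 (V : finType) (X : {set V}) u : (X :&: [set u] == set0) = (u \notin X).
Proof. by rewrite setIC setI_eq0 disjoints1. Qed.

(* Replacing [X] by its symmetric difference with [Y] matches the terms with
   [u \in X] of [G] with the terms with [u \notin X] of [H]. *)
Lemma qpoly_recursion (p : 'F_2 -> 'F_2 -> bool) (f g : 'F_2 -> 'F_2 -> 'F_2)
    (V : finType) (G H : graph V) (Y : {set V}) (u : V) :
    let q := fun a _ => a == 0 in
    u \in Y ->
    (forall a b, p (f a b) (g a b) = q a b) ->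
    (forall a b, q (f a b) (g a b) = p a b) ->
    (forall P, nul H P =
       nul G (fun i a b => if i \in Y then P i (f a b) (g a b) else P i a b)) ->
  qpoly p q G = qpoly p q (del G [set u]) + qpoly p q (del H [set u]).
Proof.
move=> q uY pfg qfg nulH.
rewrite !(qpoly_del _ _ _ (sub0set [set u])) /qpoly (bigID (fun X : {set V} => u \notin X)) /=.
congr (_ + _).
  (* When [u] is not in [X], the condition at [u] is [q], which is exactly what deleting [u]
     imposes. *)
  apply: eq_big => [X|X uX]; first by rewrite setI1_eq0.
  congr 'X^_; apply: eq_nul => i a b; rewrite in_set1.
  by case: eqP => [->|_]; [rewrite (negPf uX) | case: (i \in X)].
pose D (X : {set V}) := [set i | (i \in X) (+) (i \in Y)].
have DK : involutive D by move=> X; apply/setP=> i; rewrite !inE addbK.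
rewrite (reindex_inj (inv_inj DK)) /=; apply: eq_big => [X|X].
  by rewrite setI1_eq0 !inE uY addbT negbK.
rewrite !inE uY addbT negbK => uX.
congr 'X^_; rewrite nulH; apply: eq_nul => i a b; rewrite in_set1 inE.
(* At [u], the deletion condition on [H] is [q] and pulls back to [p]; elsewhere on [Y] the exchange
   of [p] and [q] undoes the flipped membership. *)
case: eqP => [->|_]; first by rewrite uY (negPf uX) /= -qfg.
by case: (i \in Y); case: (i \in X) => //=; rewrite ?pfg // -qfg.
Qed.

(** * The recursion for q2 at a loop-free edge *)

Section LoopFreeEdge.
Variables (V : finType) (G : graph V) (u v : V).
Hypotheses (uv : edge G u v) (Lu : ~~ loop G u) (Lv : ~~ loop G v).

Let Guv : G u v = 1. Proof. exact/eqP. Qed.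

Let loopless0 x : ~~ loop G x -> G x x = 0.
Proof. by rewrite /loop; case: (G x x) => [[|[]]] //= ? _; apply: val_inj. Qed.

Let neq_uv : u != v.
Proof. by apply: contraNneq Lu => e; move: uv; rewrite -e. Qed.

Let supp_act (x : {ffun V -> 'F_2}) : (forall i, i \notin [set u; v] -> x i = 0) ->
  act G x u = x v /\ act G x v = x u.
Proof.
move=> x0; have actE i : act G x i = G i u * x u + G i v * x v.
  rewrite /act (bigD1 u) // (bigD1 v) 1?eq_sym //= big1 ?addr0 // => j /andP[ju jv].
  by rewrite x0 ?mulr0 // !inE negb_or ju.
by rewrite !actE (adj_sym G v u) Guv !loopless0 // !mul0r !mul1r addr0 add0r.
Qed.

(** On vectors supported on {u, v}, [G] exchanges the two entries, so the pairs at [u] and [v] are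
    (a, b) and (b, a). All five definedness claims reduce to this. *)
Let nul_uv0 (P : V -> 'F_2 -> 'F_2 -> bool) :
    (forall i a b, i \notin [set u; v] -> P i a b -> a = 0) ->
    (forall a b, P u a b -> P v b a -> a = 0 /\ b = 0) ->
  nul G P = 0%N.
Proof.
move=> Pout Puv; apply: nul_eq0 => x Px.
have x0 i : i \notin [set u; v] -> x i = 0 by move=> /Pout; apply; apply: Px.
have [au av] := supp_act x0; have := Px u; have := Px v; rewrite au av.
move=> Pv /Puv/(_ Pv) [xu xv] i; have [|/x0//] := boolP (i \in [set u; v]).
by rewrite !inE => /orP[] /eqP->.
Qed.

Lemma pivot_defined_edge : pivot_defined G [set u; v].
Proof.
rewrite pivot_definedE; apply/eqP/nul_uv0 => [i a b /negPf-> /eqP //|a b].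
by rewrite !inE !eqxx orbT => /eqP-> /eqP->.
Qed.

Lemma dpivot_defined_u : dpivot_defined G [set u].
Proof.
rewrite dpivot_definedE; apply/eqP/nul_uv0 => [i a b|a b].
  by rewrite !inE negb_or => /andP[/negPf-> _] /eqP.
by rewrite !inE eqxx [v == u]eq_sym (negPf neq_uv) => /[swap] /eqP->; rewrite addr0 => /eqP.
Qed.

Lemma dpivot_defined_v : dpivot_defined G [set v].
Proof.
rewrite dpivot_definedE; apply/eqP/nul_uv0 => [i a b|a b].
  by rewrite !inE negb_or => /andP[_ /negPf->] /eqP.
by rewrite !inE eqxx (negPf neq_uv) => /eqP->; rewrite addr0 => /eqP.
Qed.

Lemma pivot_defined_dpivot : pivot_defined (dpivot G [set v]) [set u].
Proof.
rewrite pivot_definedE nul_dpivot ?dpivot_defined_v //.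
apply/eqP/nul_uv0 => [i a b|a b].
  by rewrite !inE negb_or => /andP[/negPf-> /negPf->] /eqP.
rewrite !inE !eqxx (negPf neq_uv) [v == u]eq_sym (negPf neq_uv).
by move=> /eqP->; rewrite add0r => /eqP.
Qed.

Lemma dpivot_defined_pivot : dpivot_defined (pivot G [set u; v]) [set v].
Proof.
rewrite dpivot_definedE nul_pivot ?pivot_defined_edge //.
apply/eqP/nul_uv0 => [i a b|a b].
  by rewrite !inE negb_or => /andP[/negPf-> /negPf->] /eqP.
rewrite !inE !eqxx orbT (negPf neq_uv) /=.
by move=> /eqP->; rewrite addr0 => /eqP.
Qed.

Let p (a b : 'F_2) := a + b == 0.
Let q (_ b : 'F_2) := b == 0.
Let F (X : {set V}) : {poly int} := 'X^(nul G (fun i => if i \in X then p else q)).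

(** The classes are: neither [u] nor [v] in [X], only [v], and [u] in [X]. The last ignores [v]
    because its term deletes [u] alone. *)
Lemma q2_split : q2 G = \sum_(X | X :&: [set u; v] == set0) F X
  + \sum_(X | X :&: [set u; v] == [set v]) F X
  + \sum_(X | X :&: [set u] == [set u]) F X.
Proof.
rewrite q2E /qpoly (bigID (fun X : {set V} => u \in X)) /= addrC; congr (_ + _); last first.
  by apply: eq_bigl => X; rewrite eqEsubset subsetIr subsetI subxx andbT sub1set.
rewrite (bigID (fun X : {set V} => v \in X)) /= addrC; congr (_ + _); apply: eq_bigl => X.
  by rewrite setIUr setU_eq0 !setI1_eq0.
apply/andP/eqP=> [[uX vX]|].
  apply/setP=> i; rewrite !inE; have [->|] := eqVneq i u.
    by rewrite (negPf uX) (negPf neq_uv).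
  by have [->|] := eqVneq i v; rewrite ?vX // andbF.
move/setP=> eX; have := eX u; have := eX v.
by rewrite !inE !eqxx orbT andbT (negPf neq_uv) andbT => -> ->.
Qed.

(** The conditions y_u = y_v = 0 become x_u = x_v = 0 under the pivot. *)
Lemma q2_pivot :
  q2 (del (pivot G [set u; v]) [set u; v]) =
  \sum_(X | X :&: [set u; v] == set0) F X.
Proof.
rewrite q2E (qpoly_del _ _ _ (sub0set _)); apply: eq_bigr => X /eqP X0.
congr 'X^_; rewrite nul_pivot ?pivot_defined_edge //; apply: eq_nul => i a b.
have [iU|_] := boolP (i \in [set u; v]); last by case: (i \in X).
by move/setP/(_ i): X0; rewrite in_setI iU inE andbT => ->.
Qed.

Let in_uv_v (X : {set V}) : X :&: [set u; v] = [set v] -> (u \in X = false) * (v \in X).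
Proof.
move/setP=> eX; have := eX u; have := eX v.
by rewrite !inE !eqxx orbT !andbT (negPf neq_uv) => -> ->.
Qed.

(** The pivot turns y_u = 0 into x_u = 0, and the dual pivot turns x_v + y_v = 0 into x_v = 0; the
    trace {v} keeps the index sets equal. *)
Lemma q2_dpivot_pivot :
  q2 (del (pivot (dpivot G [set v]) [set u]) [set u; v]) =
  \sum_(X | X :&: [set u; v] == [set v]) F X.
Proof.
rewrite q2E (qpoly_del _ _ _ (subsetUr [set u] [set v])).
apply: eq_bigr => X /eqP/in_uv_v[uX vX].
congr 'X^_; rewrite nul_pivot ?pivot_defined_dpivot // nul_dpivot ?dpivot_defined_v //.
apply: eq_nul => i a b; rewrite !inE.
have [->|iu] := eqVneq i u; first by rewrite (negPf neq_uv) uX.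
by have [->|iv] := eqVneq i v; [rewrite vX | case: (i \in X)].
Qed.

(** The additional exchange of x_v and y_v leaves x_v + y_v = 0 unchanged, so the same terms of q2
    arise. *)
Lemma q2_pivot_dpivot :
  q2 (del (dpivot (pivot G [set u; v]) [set v]) [set u; v]) =
  \sum_(X | X :&: [set u; v] == [set v]) F X.
Proof.
rewrite q2E (qpoly_del _ _ _ (subsetUr [set u] [set v])).
apply: eq_bigr => X /eqP/in_uv_v[uX vX].
congr 'X^_; rewrite nul_dpivot ?dpivot_defined_pivot // nul_pivot ?pivot_defined_edge //.
apply: eq_nul => i a b; rewrite !inE.
have [->|iu] := eqVneq i u; first by rewrite (negPf neq_uv) uX.
by have [->|iv] := eqVneq i v; [rewrite vX addrC | case: (i \in X)].
Qed.

Lemma q2_dpivot :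
  q2 (del (dpivot G [set u]) [set u]) = \sum_(X | X :&: [set u] == [set u]) F X.
Proof.
rewrite q2E (qpoly_del _ _ _ (subxx _)); apply: eq_bigr => X /eqP/setIidPr.
rewrite sub1set => uX; congr 'X^_; rewrite nul_dpivot ?dpivot_defined_u //.
apply: eq_nul => i a b; rewrite !inE.
by have [->|iu] := eqVneq i u; [rewrite uX | case: (i \in X)].
Qed.

End LoopFreeEdge.

Theorem theorem34 (V : finType) (G : graph V) :
  (forall (X : {set V}) (u : V), u \in X -> pivot_defined G X ->
     q1 G = q1 (del G [set u]) + q1 (del (pivot G X) [set u]))
  /\
  (forall u v : V, edge G u v -> ~~ loop G u -> ~~ loop G v ->
     [/\ pivot_defined G [set u; v],
         dpivot_defined G [set v],
         pivot_defined (dpivot G [set v]) [set u],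
         dpivot_defined (pivot G [set u; v]) [set v]
       & dpivot_defined G [set u]]
     /\
     q2 G = q2 (del (pivot G [set u; v]) [set u; v])
          + q2 (del (pivot (dpivot G [set v]) [set u]) [set u; v])
          + q2 (del (dpivot G [set u]) [set u])
     /\
     q2 G = q2 (del (pivot G [set u; v]) [set u; v])
          + q2 (del (dpivot (pivot G [set u; v]) [set v]) [set u; v])
          + q2 (del (dpivot G [set u]) [set u]))
  /\
  (forall (Y : {set V}) (u : V), u \in Y -> dpivot_defined G Y ->
     q3 G = q3 (del G [set u]) + q3 (del (dpivot G Y) [set u])).
Proof.
split; last split.
- move=> X u uX GX; rewrite !q1E.
  (* The pivot sends the pair (a, b) to (b, a), exchanging b = 0 and a = 0. *)
  exact: (qpoly_recursion (f := fun _ b => b) (g := fun a _ => a) uX _ _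
    (fun P => nul_pivot P GX)).
- move=> u v uv Lu Lv; split.
    split; [exact: pivot_defined_edge | exact: (dpivot_defined_v uv)
      | exact: pivot_defined_dpivot | exact: dpivot_defined_pivot
      | exact: (dpivot_defined_u uv)].
  rewrite (q2_split uv Lu) q2_pivot // q2_dpivot_pivot // q2_pivot_dpivot //.
  by rewrite (q2_dpivot uv).
- move=> Y u uY GY; rewrite !q3E.
  (* The dual pivot sends (a, b) to (a + b, b), exchanging a + b = 0 and a = 0. *)
  apply: (qpoly_recursion (f := fun a b => a + b) (g := fun _ b => b) uY) => // [a b|P].
    by rewrite -addrA addF2_self addr0.
  exact: nul_dpivot.
Qed.
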